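(* Let $n\ge 7$ and let $G$ be a connected graph of order $n$. If $\rho(G)\ge n-3+\frac{1}{n-3}$, then $G$ contains a HIST.
   Context: All graphs are finite, simple and undirected. The order of a graph is its number of vertices. $\rho(G)$ denotes the spectral radius of $G$, i.e. the largest eigenvalue of its adjacency matrix. A homeomorphically irreducible spanning tree (HIST) of a connected graph $G$ is a spanning tree $T$ of $G$ such that $T$ has no vertex of degree $2$ (degree taken in $T$). *)

(* Defs.v *)
From mathcomp Require Import all_boot all_order all_algebra.
From mathcomp Require Import classical_sets reals.
Set Implicit Arguments.
Unset Strict Implicit.
Unset Printing Implicit Defensive.
Import Order.TTheory GRing.Theory Num.Theory.
Local Open Scope ring_scope.

(* A finite simple undirected graph is an adjacency relation on a finType of
   vertices that is symmetric and irreflexive. *)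
Definition simple_graph (T : finType) (e : rel T) : Prop :=
  symmetric e /\ irreflexive e.

Definition connected_graph (T : finType) (e : rel T) : Prop :=
  forall x y : T, connect e x y.

Definition degree (T : finType) (e : rel T) (x : T) : nat :=
  #|[set y | e x y]|.

(* A duplicate-free closed walk of size at most 2 is empty, a loop, or an edge
   traversed back and forth, hence not a cycle of a simple graph. *)
Definition acyclic_graph (T : finType) (e : rel T) : Prop :=
  forall c : seq T, ucycle e c -> (size c <= 2)%N.

(* [t] has the whole of [T] as vertex set, which makes it spanning. *)
Definition spanning_tree (T : finType) (e t : rel T) : Prop :=
  [/\ simple_graph t, subrel t e, connected_graph t & acyclic_graph t].

Definition has_HIST (T : finType) (e : rel T) : Prop :=
  exists t : rel T, spanning_tree e t /\ forall x : T, degree t x <> 2%N.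

Definition adjacency_mx (R : realType) (T : finType) (e : rel T) :
    'M[R]_#|T| :=
  \matrix_(i, j) (e (enum_val i) (enum_val j))%:R.

(* The adjacency matrix of a nonempty simple graph is real symmetric, so its
   set of eigenvalues is finite and nonempty and this supremum is a maximum. *)
Definition spectral_radius (R : realType) (T : finType) (e : rel T) : R :=
  sup [set a : R | eigenvalue (adjacency_mx R e) a]%classic.

(* Main.v *)
Require Import Defs.
From mathcomp Require Import all_boot all_order all_algebra.
From mathcomp Require Import boolp classical_sets reals.
From mathcomp Require Import zify.
Set Implicit Arguments.
Unset Strict Implicit.
Unset Printing Implicit Defensive.
Import Order.TTheory GRing.Theory Num.Theory.
Local Open Scope ring_scope.

(* The row sums of the squared adjacency matrix are S(u), the sum of the degrees
   of the neighbours of u, so every eigenvalue l satisfies l^2 <= S(u) for some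
   u, and the spectral hypothesis yields u with S(u) >= (n-3)^2 + 3.  A vertex of
   degree n-1 gives a spanning star.  Otherwise some p has degree n-2 (else
   S(u) <= (n-3)^2); let w be its only non-neighbour.  If a neighbour q of w has
   a neighbour x other than p and w, the double star with adjacent centres p and
   q, where q carries the leaves w and x, is a HIST.  If not, the a >= 1
   neighbours of w have degree 2 and the remaining b = n-2-a vertices have degree
   at most b, so the degree sum is at most (n-2) + a + 2a + b^2
   <= (n-3)^2 + n + 1, whereas S(u) + n - 1 bounds it from below because all
   degrees are positive. *)

(** * Spanning trees encoded by parent maps *)

Definition parent_rel (T : finType) (f : T -> T) : rel T :=
  fun x y => (x != y) && ((f x == y) || (f y == x)).

Lemma parent_rel_sym (T : finType) (f : T -> T) : symmetric (parent_rel f).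
Proof. by move=> x y; rewrite /parent_rel eq_sym orbC. Qed.

(** The height [h] drops at each step from a vertex other than [r] to its parent, so iterating [f]
    reaches [r], and a cycle fails at its highest vertex. The root is a fixed point of [f]; the
    clause [x != y] of [parent_rel] discards its loop. *)
Lemma parent_rel_tree (T : finType) (e : rel T) (r : T) (f : T -> T)
    (h : T -> nat) :
  symmetric e -> f r = r ->
  (forall x, x != r -> (h (f x) < h x)%N) ->
  (forall x, x != r -> e x (f x)) ->
  spanning_tree e (parent_rel f).
Proof.
move=> e_sym fr hf ef.
(* A child lies strictly above its parent, so an endpoint that is not the higher one must be the
   parent. *)
have parentP x y : parent_rel f x y -> (h y <= h x)%N -> y = f x.
  case/andP=> xy /orP[/eqP-> //|/eqP fyx] hyx.
  have yr : y != r by apply: contraNneq xy => yr; rewrite -fyx yr fr.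
  by move: (hf _ yr); rewrite fyx ltnNge hyx.
split.
- split; first exact: parent_rel_sym.
  by move=> x; rewrite /parent_rel eqxx.
- move=> x y /andP[xy /orP[/eqP fxy|/eqP fyx]].
    rewrite -fxy; apply: ef.
    by apply: contraNneq xy => xr; rewrite -fxy xr fr.
  rewrite e_sym -fyx; apply: ef.
  by apply: contraNneq xy => yr; rewrite -fyx yr fr.
- have to_root x : connect (parent_rel f) x r.
    elim: {x}(h x).+1 {-2}x (ltnSn (h x)) => // m IHm x; rewrite ltnS => hx.
    have [->|xr] := eqVneq x r; first exact: connect0.
    have hfx := hf _ xr.
    apply: connect_trans (IHm _ (leq_trans hfx hx)); apply: connect1.
    rewrite /parent_rel eqxx andbT.
    by apply: contraTneq hfx => <-; rewrite ltnn.
  move=> x y; apply: connect_trans (to_root x) _.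
  by rewrite (sym_connect_sym (parent_rel_sym f)).
(* Both neighbours on the cycle of a vertex of maximal height are its parent. *)
- move=> c /andP[cyc_c uniq_c]; rewrite leqNgt; apply/negP => size_c.
  have [x0 x0c] : exists x0, x0 \in c.
    by case: c size_c {cyc_c uniq_c} => // x c _; exists x; apply: mem_head.
  case: (arg_maxnP h x0c) => x xc hmax.
  have [i c' c'E] := rot_to xc.
  have c'_c z : z \in x :: c' -> z \in c by rewrite -c'E mem_rot.
  move: cyc_c uniq_c size_c; rewrite -(rot_cycle i) -(rot_uniq i).
  rewrite -(size_rot i) c'E.
  (* The size bound leaves a cycle [x, y, ..., z] in which [y] and [z] are distinct entries. *)
  case: c' c'_c {c'E} => // y c'; case/lastP: c' => // c' z c'_c.
  rewrite /= rcons_path last_rcons => /and3P[xy _ zx] /and3P[_ ync _] _.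
  have yE : y = f x.
    by apply: parentP xy (hmax _ (c'_c _ _)); rewrite !inE eqxx orbT.
  have zE : z = f x.
    rewrite parent_rel_sym in zx; apply: parentP zx (hmax _ (c'_c _ _)).
    by rewrite !inE mem_rcons !inE eqxx !orbT.
  by rewrite yE -zE mem_rcons mem_head in ync.
Qed.

(** The centre of the star has degree [#|T| - 1], which is 2 only for three vertices; all other
    vertices are leaves. *)
Lemma star_HIST (T : finType) (e : rel T) (p : T) :
  symmetric e -> #|T| != 3%N -> (forall x, x != p -> e p x) -> has_HIST e.
Proof.
move=> e_sym cardT ep; exists (parent_rel (fun=> p)); split.
  apply: (@parent_rel_tree _ _ p _ (fun x => (x != p) : nat)) => //.
    by move=> x ->; rewrite eqxx.
  by move=> x /ep; rewrite e_sym.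
move=> x; rewrite /degree /parent_rel; have [->|xp] := eqVneq x p.
  rewrite (_ : [set _ | _] = [set~ p]); last first.
    by apply/setP => y; rewrite !inE orbT andbT eq_sym.
  by rewrite cardsC1; lia.
rewrite (_ : [set _ | _] = [set p]) ?cards1 //.
apply/setP => y; rewrite !inE orbF [y == p]eq_sym.
by case: (eqVneq p y) => [<-|_]; rewrite ?andbF // andbT xp.
Qed.

(** In the double star [q] has degree 3, with neighbours [p], [a], [b], while [p] has degree
    [#|T| - 3], at least 3; all other vertices are leaves. *)
Lemma double_star_HIST (T : finType) (e : rel T) (p q a b : T) :
  symmetric e -> (6 <= #|T|)%N -> uniq [:: p; q; a; b] ->
  e q a -> e q b -> (forall x, x \notin [:: p; a; b] -> e p x) -> has_HIST e.
Proof.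
move=> e_sym cardT; rewrite /= !inE !negb_or !andbT.
move=> /and3P[/and3P[pq pa pb] /andP[qa qb] ab] eqa eqb ep.
pose f x := if (x == a) || (x == b) then q else p.
have fE : (f p = p) * (f q = p) * (f a = q) * (f b = q).
  by rewrite /f (negPf pa) (negPf pb) (negPf qa) (negPf qb) !eqxx orbT.
exists (parent_rel f); split.
  apply: (@parent_rel_tree _ _ p _
            (fun x => (x != p) + ((x == a) || (x == b)))%N) => //.
  - by rewrite fE.
  - move=> x xp; rewrite /f xp; case: ifP => _.
      by rewrite (negPf qa) (negPf qb) addn0 addn1; case: (q != p).
    by rewrite eqxx (negPf pa) (negPf pb).
  - move=> x xp; rewrite /f e_sym; case: ifP => [/orP[]/eqP-> //|xab].
    by apply: ep; rewrite !inE (negPf xp) xab.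
move=> x; rewrite /degree /parent_rel.
have [->|xp] := eqVneq x p.
  rewrite (_ : [set _ | _] = ~: (p |: [set a; b])).
    have := cardsC (p |: [set a; b]).
    by rewrite cardsU1 cards2 !inE negb_or pa pb ab; lia.
  apply/setP => y; rewrite !inE fE /f.
  case: (eqVneq p y) => [<-|py]; first by [].
  by case: ifP; rewrite ?eqxx // [q == p]eq_sym (negPf pq).
have [->|xq] := eqVneq x q.
  rewrite (_ : [set _ | _] = (p |: [set a; b])).
    by rewrite cardsU1 cards2 !inE negb_or pa pb ab.
  apply/setP => y; rewrite !inE fE /f [p == y]eq_sym.
  case: (eqVneq y p) => [->|yp] /=; first by rewrite eq_sym pq.
  case: (eqVneq y a) => [->|ya] /=; first by rewrite qa eqxx.
  case: (eqVneq y b) => [->|yb] /=; first by rewrite qb eqxx.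
  by rewrite (negPf pq) andbF.
rewrite (_ : [set _ | _] = [set f x]) ?cards1 //.
apply/setP => y; rewrite !inE [y == f x]eq_sym.
(* The only values of [f] are [p] and [q], so any other vertex has no children. *)
have -> : (f y == x) = false.
  by apply/eqP => fyx; move: xp xq; rewrite -fyx /f; case: ifP; rewrite eqxx.
rewrite orbF; case: (eqVneq (f x) y) => [<-|_]; last by rewrite andbF.
by rewrite andbT /f; case: ifP.
Qed.

(** * Walks of length two and the spectral radius *)

Definition two_walks (T : finType) (e : rel T) (u : T) : nat :=
  (\sum_(v | e u v) degree e v)%N.

Lemma connected_degree_gt0 (T : finType) (e : rel T) (x : T) :
  connected_graph e -> (1 < #|T|)%N -> (0 < degree e x)%N.
Proof.
move=> e_conn cardT.
have /card_gt0P[y] : (0 < #|[set~ x]|)%N by rewrite cardsC1; lia.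
rewrite !inE; case/connectP: (e_conn x y) => [[|z s] /= + ->]; first by rewrite eqxx.
by move=> /andP[xz _] _; apply/card_gt0P; exists z; rewrite inE.
Qed.

(** Outside the neighbourhood of [u], the vertex [u] contributes its degree, and each of the other
    [#|T| - 1 - degree e u] vertices contributes at least 1. *)
Lemma two_walks_le (T : finType) (e : rel T) (u : T) :
  irreflexive e -> (forall x, 0 < degree e x)%N ->
  (two_walks e u + #|T|.-1 <= \sum_x degree e x)%N.
Proof.
move=> e_irr d_gt0; rewrite [leqRHS](bigID (e u)) /= leq_add2l.
have ue : ~~ e u u by rewrite e_irr.
rewrite (bigD1 u ue) /=.
have -> : #|T|.-1 = (degree e u + \sum_(x | ~~ e u x && (x != u)) 1)%N.
  rewrite sum1_card; have := cardsC (u |: [set y | e u y]).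
  rewrite cardsU1 !inE ue /degree => <-; rewrite add1n addSn /=.
  congr (_ + _)%N; apply: eq_card => x; rewrite !inE unfold_in /=.
  by rewrite negb_or andbC.
by rewrite leq_add2l; apply: leq_sum => x _.
Qed.

(** At a coordinate [i] of an eigenvector [v] with [|v_i|] maximal, the eigenvalue equation is used
    twice: at [i], and then at each neighbour [j], where it gives [|l| |v_j| <= |v_i| deg(j)]. *)
Lemma eigenvalue_two_walks (R : realType) (T : finType) (e : rel T) (l : R) (B : nat) :
  symmetric e -> eigenvalue (adjacency_mx R e) l ->
  (forall u, two_walks e u <= B)%N -> l ^+ 2 <= B%:R.
Proof.
move=> e_sym /eigenvalueP[v vA v_neq0] SB.
have [j0 vj0] : exists j, v 0 j != 0.
  by apply/rV0Pn.
case: (@Order.TotalTheory.arg_maxP _ _ _ j0 predT (fun j => `|v 0 j|) isT)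
  => i _ imax.
have vi_gt0 : 0 < `|v 0 i|.
  by apply: lt_le_trans (imax j0 isT); rewrite normr_gt0.
set A := adjacency_mx R e in vA.
have A_ge0 j k : 0 <= A j k by rewrite mxE ler0n.
have degE j : \sum_k A k j = (degree e (enum_val j))%:R.
  rewrite /degree -sum1dep_card natr_sum.
  rewrite (reindex (@enum_val _ T)) /=; last first.
    by apply: onW_bij; apply: enum_val_bij.
  rewrite [RHS]big_mkcond /=; apply: eq_bigr => k _.
  by rewrite mxE e_sym; case: ifP.
have walksE : \sum_j (\sum_k A k j) * A j i = (two_walks e (enum_val i))%:R.
  rewrite /two_walks natr_sum (reindex (@enum_val _ T)) /=; last first.
    by apply: onW_bij; apply: enum_val_bij.
  rewrite [RHS]big_mkcond /=; apply: eq_bigr => j _.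
  by rewrite degE mxE e_sym; case: ifP => _; rewrite ?mulr1 ?mulr0.
have vAE j : `|l| * `|v 0 j| <= `|v 0 i| * \sum_k A k j.
  have -> : `|l| * `|v 0 j| = `|\sum_k v 0 k * A k j|.
    by rewrite -normrM; congr `| _ |; have /rowP/(_ j) := vA; rewrite !mxE.
  rewrite mulr_sumr; apply: le_trans (ler_norm_sum _ _ _) _.
  apply: ler_sum => k _; rewrite normrM (ger0_norm (A_ge0 _ _)).
  by apply: ler_wpM2r => //; apply: imax.
have : `|l| ^+ 2 * `|v 0 i| <= `|v 0 i| * (two_walks e (enum_val i))%:R.
  rewrite -walksE mulr_sumr expr2 -mulrA.
  have -> : `|l| * `|v 0 i| = `|\sum_k v 0 k * A k i|.
    by rewrite -normrM; congr `| _ |; have /rowP/(_ i) := vA; rewrite !mxE.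
  rewrite -normrM mulr_sumr; apply: le_trans (ler_norm_sum _ _ _) _.
  apply: ler_sum => k _; rewrite !normrM (ger0_norm (A_ge0 _ _)) !mulrA.
  by apply: ler_wpM2r.
rewrite mulrC ler_pM2l // real_normK ?num_real // => /le_trans; apply.
by rewrite ler_nat.
Qed.

Lemma spectral_radius_le (R : realType) (T : finType) (e : rel T) (B : nat) :
  symmetric e -> (forall u, two_walks e u <= B)%N ->
  spectral_radius R e <= Num.sqrt B%:R.
Proof.
move=> e_sym SB; rewrite /spectral_radius.
set E := [set _ | _]%classic.
have E_le : ubound E (Num.sqrt (B%:R : R)).
  move=> l /= l_eig; apply: le_trans (ler_norm _) _; rewrite -sqrtr_sqr.
  by apply: ler_wsqrtr; apply: eigenvalue_two_walks l_eig SB.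
(* For an empty spectrum [sup] takes its default value 0. *)
have [E0|] := (pselect (E !=set0)%classic); first exact: ge_sup.
by move=> /set0P/negP; rewrite negbK => /eqP->; rewrite sup0 sqrtr_ge0.
Qed.

(** * Graphs with a vertex of degree at least n-2 *)

Lemma degree_max_neighbor (T : finType) (e : rel T) (p x : T) :
  irreflexive e -> (#|T|.-1 <= degree e p)%N -> x != p -> e p x.
Proof.
move=> e_irr dp xp.
have /eqP : [set y | e p y] == [set~ p].
  rewrite eqEcard cardsC1 [X in _ && X]dp andbT; apply/fintype.subsetP => y; rewrite !inE.
  by apply: contraTneq => ->; rewrite e_irr.
by move/setP/(_ x); rewrite !inE xp.
Qed.

Lemma degree_unique_nonneighbor (T : finType) (e : rel T) (p : T) :
  irreflexive e -> degree e p = #|T|.-2 -> (1 < #|T|)%N ->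
  exists w, [/\ w != p, ~~ e p w & forall x, x != p -> x != w -> e p x].
Proof.
move=> e_irr dp cardT.
have /cards1P[w wP] : #|~: (p |: [set y | e p y])| == 1%N.
  have := cardsC (p |: [set y | e p y]).
  by rewrite cardsU1 inE e_irr; rewrite /degree in dp; rewrite dp; lia.
have wE x : ((x != p) && ~~ e p x) = (x == w).
  by move/setP/(_ x): wP; rewrite !inE negb_or.
have /andP[wp epw] : (w != p) && ~~ e p w by rewrite wE.
by exists w; split=> // x xp; rewrite -wE xp /= negbK.
Qed.

Lemma pendant_degree_sum_le (T : finType) (e : rel T) (p w : T) :
  symmetric e -> irreflexive e -> (7 <= #|T|)%N -> degree e p = #|T|.-2 ->
  w != p -> ~~ e p w -> (0 < degree e w)%N ->
  (forall q x, e w q -> e q x -> x \in [:: p; w]) ->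
  (\sum_x degree e x <= (#|T| - 3) ^ 2 + #|T| + 1)%N.
Proof.
move=> e_sym e_irr cardT dp wp epw dw wN.
pose A := [set y | e w y]; pose a := degree e w; pose B := ~: (p |: (w |: A)).
have cardB : (#|B| + a + 2 = #|T|)%N.
  have := cardsC (p |: (w |: A)).
  rewrite !cardsU1 !inE e_irr negb_or eq_sym wp e_sym epw -/a /= => <-.
  by rewrite /a /degree -/A -/B; lia.
have dA x : x \in A -> (degree e x <= 2)%N.
  rewrite inE => wx; apply: leq_trans (_ : #|[set p; w]| <= 2)%N; last first.
    by rewrite cards2; case: (_ == _).
  apply: subset_leq_card; apply/fintype.subsetP => y; rewrite inE => xy.
  by have := wN _ _ wx xy; rewrite !inE.
have dB x : x \in B -> (degree e x <= #|B|)%N.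
  rewrite !inE !negb_or => /and3P[xp xw wx].
  (* A vertex [x] of [B] is adjacent neither to [w] nor to any vertex of [A], whose neighbours are
     among [p] and [w]. Trading [x] itself for [p] leaves at most [#|B|] neighbours. *)
  apply: leq_trans (_ : #|p |: (B :\ x)| <= _)%N.
    apply: subset_leq_card; apply/fintype.subsetP => y; rewrite !inE => xy.
    have [//|yp /=] := eqVneq y p.
    rewrite negb_or; apply/and3P; split.
    - by apply: contraTneq xy => ->; rewrite e_irr.
    - by apply: contraTneq xy => ->; rewrite e_sym.
    - apply/negP => wy; rewrite e_sym in xy.
      by have := wN _ _ wy xy; rewrite !inE (negPf xp) (negPf xw).
  have xB : x \in B by rewrite !inE !negb_or xp xw.
  by rewrite [leqRHS](cardsD1 x) xB cardsU1; case: (_ \notin _).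
have -> : (\sum_x degree e x =
    degree e p + (a + (\sum_(x in A) degree e x + \sum_(x in B) degree e x)))%N.
  rewrite (bigD1 p) // (bigD1 w) //= (bigID (mem A)) /=; congr (_ + (_ + (_ + _)))%N.
    apply: eq_bigl => x; rewrite !inE.
    have [->|xp] := eqVneq x p; first by rewrite e_sym (negPf epw).
    by have [->|//] := eqVneq x w; rewrite e_irr.
  by apply: eq_bigl => x; rewrite !inE !negb_or andbA.
have sumA : (\sum_(x in A) degree e x <= a * 2)%N.
  by rewrite -sum_nat_const; apply: leq_sum.
have sumB : (\sum_(x in B) degree e x <= #|B| * #|B|)%N.
  by rewrite -sum_nat_const; apply: leq_sum.
rewrite dp.
rewrite -/a in dw *; move: sumA sumB cardB cardT dw => /=.
(* With b = n-2-a, the bound n-2+3a+b^2 is convex in a on [1, n-2]. At a = 1 it equals the claimed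
   bound; at a = n-2 it is 4n-8, which is small enough since (n-3)(n-6) >= 0. *)
move: (\sum_(x in A) _)%N (\sum_(x in B) _)%N a #|B| #|T| => sA sB a b n; nia.
Qed.

Lemma two_walks_ge_HIST (T : finType) (e : rel T) (u : T) :
  simple_graph e -> connected_graph e -> (7 <= #|T|)%N ->
  ((#|T| - 3) ^ 2 + 3 <= two_walks e u)%N -> has_HIST e.
Proof.
move=> [e_sym e_irr] e_conn cardT walks_u.
have d_gt0 x : (0 < degree e x)%N by apply: connected_degree_gt0 => //; lia.
have [p dp] : exists p, (#|T|.-2 <= degree e p)%N.
  apply/existsP; apply: contraLR walks_u.
  rewrite negb_exists => /forallP d_small; rewrite -ltnNge.
  have d_le x : (degree e x <= #|T| - 3)%N.
    by have := d_small x; rewrite -ltnNge; lia.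
  apply: leq_ltn_trans (_ : \sum_(v | e u v) (#|T| - 3) < _)%N.
    exact: leq_sum.
  rewrite sum_nat_cond_const -/(degree e u).
  by have := leq_mul (d_le u) (leqnn (#|T| - 3)); rewrite mulnn; lia.
have [dp1|dp1] := leqP #|T|.-1 (degree e p).
  apply: (@star_HIST _ _ p) => //; first by lia.
  by move=> x; apply: degree_max_neighbor.
have {dp1} dpE : degree e p = #|T|.-2 by lia.
have [|w [wp epw ep]] := degree_unique_nonneighbor e_irr dpE; first by lia.
have [/existsP[q /existsP[x /and3P[wq qx xpw]]]|no_qx] :=
  boolP [exists q, exists x, [&& e w q, e q x & x \notin [:: p; w]]].
  have qp : q != p by apply: contraNneq epw => <-; rewrite e_sym.
  have qw : q != w by apply: contraTneq wq => ->; rewrite e_irr.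
  have qx' : q != x by apply: contraTneq qx => ->; rewrite e_irr.
  move: xpw; rewrite !inE negb_or => /andP[xp xw].
  (* Only [w] and possibly [x] are out of reach of [p], and both hang from [q]. *)
  apply: (@double_star_HIST _ e p q w x) => //; first by lia.
  - rewrite /= !inE !negb_or ![p == _]eq_sym qp wp xp qw qx'.
    by rewrite eq_sym xw.
  - by rewrite e_sym.
  - by move=> y; rewrite !inE !negb_or => /and3P[yp yw _]; apply: ep.
have wN q x : e w q -> e q x -> x \in [:: p; w].
  move=> wq qx; apply: contraNT no_qx => xpw.
  by apply/existsP; exists q; apply/existsP; exists x; rewrite wq qx.
(* The two bounds on the degree sum force [two_walks e u] to be at most (n-3)^2 + 2, one less than
   assumed. *)
have := pendant_degree_sum_le e_sym e_irr cardT dpE wp epw (d_gt0 w) wN.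
by have := two_walks_le u e_irr d_gt0; lia.
Qed.

Theorem corollary1p3 (R : realType) (n : nat) (T : finType) (e : rel T)
    (n_ge7 : (7 <= n)%N) (order_n : #|T| = n)
    (e_simple : simple_graph e) (e_conn : connected_graph e)
    (rho_ge : n%:R - 3 + 1 / (n%:R - 3) <= spectral_radius R e) :
  has_HIST e.
Proof.
subst n; have [e_sym _] := e_simple.
have [/existsP[u]|] := boolP [exists u, ((#|T| - 3) ^ 2 + 3 <= two_walks e u)%N].
  exact: two_walks_ge_HIST.
rewrite negb_exists => /forallP walks_small.
have {}walks_small u : (two_walks e u <= (#|T| - 3) ^ 2 + 2)%N.
  by have := walks_small u; rewrite -ltnNge addn3 ltnS -addn2.
have := le_trans rho_ge (spectral_radius_le R e_sym walks_small).
rewrite -natrB; last by lia.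
set k := (#|T| - 3)%N.
have k_gt0 : 0 < k%:R :> R by rewrite ltr0n /k; lia.
have r_ge0 : 0 <= k%:R + 1 / k%:R :> R by rewrite addr_ge0 ?divr_ge0 // ltW.
(* Squaring gives (k + 1/k)^2 = k^2 + 2 + 1/k^2, which strictly exceeds k^2 + 2; hence the integer
   threshold k^2 + 3 for [two_walks]. *)
rewrite -ler_sqr ?nnegrE ?sqrtr_ge0 // sqr_sqrtr ?ler0n // natrD natrX sqrrD.
rewrite mul1r divff ?gt_eqF // -addrA lerD2l gerDl.
by rewrite leNgt exprn_gt0 // invr_gt0.
Qed.
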